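(* Let $n>1$ be an odd integer. Then the Galois group of $D(T)=T^{2n}-xT^n+1$ over $\mathbb{Q}(x)$ is isomorphic to the direct product of the automorphism group of a dihedral group of order $2n$ with a group of order $2$.
   Context: $\mathbb{Q}(x)$ is the field of rational functions in an indeterminate $x$ over $\mathbb{Q}$, and $D(T)$ is regarded as a polynomial in $\mathbb{Q}(x)[T]$. *)

(* Defs.v *)
From HB Require Import structures.
From mathcomp Require Import all_boot all_order all_algebra.
From mathcomp Require Import all_fingroup all_solvable all_field.

Set Implicit Arguments.
Unset Strict Implicit.
Unset Printing Implicit Defensive.

Import GRing.Theory.
Local Open Scope ring_scope.

Definition Qx : fieldType := {fraction {poly rat}}.

Definition x_Qx : Qx := @tofrac {poly rat} 'X.

Definition D_poly (n : nat) : {poly Qx} := 'X^(2 * n) - x_Qx *: 'X^n + 1.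

(* [1%VS] is the copy of [F] inside [L], so [L] is generated over [F] by the
   roots of [p]. *)
Definition splitting_field_of (F : fieldType) (p : {poly F})
    (L : splittingFieldType F) : Prop :=
  splittingFieldFor 1%VS (map_poly (in_alg L) p) fullv.

(* Main.v *)
Require Import Defs.
From HB Require Import structures.
From mathcomp Require Import all_boot all_order all_algebra.
From mathcomp Require Import all_fingroup all_solvable all_field.
Import GRing.Theory.
Local Open Scope group_scope.

(** Let t be a root of D in the splitting field L. As x = t^n + t^-n, the
    roots of D are the zeta^i t and the zeta^i t^-1, where zeta is a primitive
    n-th root of unity; so L = Q(x)(zeta, t), and an element s of the Galois
    group is determined by the pair (s zeta, s t), for which there are at most
    phi(n) * 2n possibilities.

    All these pairs occur, because [L : Q(x)] >= phi(n) * 2n: the products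
    zeta^i t^j with i < phi(n) and j < 2n are linearly independent over Q(x)
    ([laurent_independence]). After clearing denominators, a dependence
    relation between them becomes a polynomial relation for t over Q(zeta).
    Since x is transcendental over Q, so is t, and this relation is trivial.
    That the original relation is then trivial too follows from the argument
    that computes the degree of k(t) over k(A(t)/B(t))
    ([homogeneous_form_eq0]), applied to x = (t^2n + 1) / t^n, together with
    the irreducibility of the cyclotomic polynomial over Q
    ([prim_root_rat_poly_eq0]).

    Let H be the stabilizer of zeta. It is normal, and it is dihedral of order
    2n, generated by r : t |-> zeta t and s : t |-> t^-1. So Gal acts on H by
    conjugation, and it also acts on the pair {t^n, t^-n}. This gives a
    morphism from Gal to the product of Aut(H) and a group of order 2. It is
    injective: an element that commutes with r and s and fixes t^n fixes zeta
    and sends t to zeta^i t with zeta^2i = 1, whence zeta^i = 1 as n is odd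
    ([cent_cyclotomic_stabilizer_eq1]). It is surjective by counting, since an
    automorphism of H sends r to a generator of <r> and s to a reflection,
    hence |Aut(H)| <= phi(n) * n ([card_Aut_dihedral_leq]). *)

Set Implicit Arguments.
Unset Strict Implicit.
Unset Printing Implicit Defensive.

Local Open Scope ring_scope.

(** * Relations over the field generated by a rational function *)

(** With u = A(t) / B(t) and m the degree of A, this is what makes
    1, t, ..., t^(m-1) independent over K(u): a relation of degree d in u,
    multiplied by B^d, is a sum of this shape. Reducing modulo B shows that B
    divides r_d, since B is coprime to A. After division by B, the term in A^d
    has degree at least m d while all others have smaller degree, so
    r_d = 0, and d can be decreased. *)
Lemma homogeneous_form_eq0 (K : fieldType) (A B : {poly K}) (m d : nat)
    (r : nat -> {poly K}) :
    coprimep A B -> B != 0 -> size A = m.+1 -> (size B <= m.+1)%N ->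
    (forall k, (size (r k) <= m)%N) ->
    \sum_(k < d.+1) r k * A ^+ k * B ^+ (d - k) = 0 ->
  forall k, (k <= d)%N -> r k = 0.
Proof.
move=> coAB B0 szA szB szr.
have A0 : A != 0 by rewrite -size_poly_gt0 szA.
elim: d => [|d IHd] sum0 k.
  rewrite leqn0 => /eqP->; move: sum0.
  by rewrite big_ord_recl big_ord0 !expr0 !mulr1 addr0.
pose S := \sum_(k < d.+1) r k * A ^+ k * B ^+ (d - k).
have splitS : B * S = - (r d.+1 * A ^+ d.+1).
  apply/eqP; rewrite -addr_eq0 -sum0 [in X in _ == X]big_ord_recr /= subnn.
  rewrite expr0 mulr1; apply/eqP; congr (_ + _).
  rewrite mulr_sumr; apply: eq_bigr => i _.
  by rewrite subSn ?exprS 1?mulrCA // -ltnS.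
have B_dvd : B %| r d.+1.
  have coBA : coprimep B (A ^+ d.+1) by rewrite coprimep_expr // coprimep_sym.
  by rewrite -(Gauss_dvdpl _ coBA) -dvdpNr -splitS dvdp_mulr.
have rd0 : r d.+1 = 0.
  have [s def_s] := dvdpP _ _ B_dvd.
  have [s0 | s_neq0] := eqVneq s 0; first by rewrite def_s s0 mul0r.
  have eqS : S = - (s * A ^+ d.+1).
    by apply: (mulfI B0); rewrite splitS def_s mulrN -!mulrA [s * _]mulrCA.
  have szX e : size (A ^+ e) = (m * e).+1.
    by rewrite polySpred ?expf_neq0 // size_exp szA.
  have szS : (size S <= m * d.+1)%N.
    apply: (leq_trans (size_sum _ _ _)); apply/bigmax_leqP => i _.
    have lid : (i <= d)%N by rewrite -ltnS.
    have szBX : (size (B ^+ (d - i)) <= (m * (d - i)).+1)%N.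
      apply: leq_trans (size_poly_exp_leq _ _) _; rewrite ltnS leq_mul2r.
      by rewrite -subn1 leq_subLR add1n szB orbT.
    apply: (leq_trans (size_polyMleq _ _)).
    apply: (@leq_trans (size (r i * A ^+ i)%R + m * (d - i))%N).
      by rewrite -subn1 leq_subLR add1n -addnS leq_add2l.
    have : (size (r i * A ^+ i)%R <= m + m * i)%N.
      apply: (leq_trans (size_polyMleq _ _)); rewrite szX addnS /=.
      by rewrite leq_add2r.
    move=> szrA; apply: (@leq_trans (m + m * i + m * (d - i))%N).
      by rewrite leq_add2r.
    by rewrite -addnA -mulnDr subnKC // mulnS.
  move: szS; rewrite eqS size_polyN size_mul ?expf_neq0 // szX addnS /=.
  have [c sc] : exists c, size s = c.+1.
    by exists (size s).-1; rewrite prednK ?size_poly_gt0.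
  by rewrite sc addSn ltnNge leq_addl.
rewrite leq_eqVlt => /predU1P[->// | ]; rewrite ltnS; apply: IHd.
by apply: (mulfI B0); rewrite mulr0 splitS rd0 mul0r oppr0.
Qed.

(** * Primitive roots of unity in a field containing the rationals *)

(** A common root in the algebraic numbers would be a primitive n-th root of
    unity, whose minimal polynomial over Q has degree phi(n), too large to
    divide q. *)
Lemma coprimep_Cyclotomic (n : nat) (q : {poly rat}) :
    (0 < n)%N -> q != 0 -> (size q <= totient n)%N ->
  coprimep (map_poly intr 'Phi_n) q.
Proof.
move=> n_gt0 q0 szq; rewrite -(coprimep_map (@ratr algC)).
have -> : map_poly (@ratr algC) (map_poly intr 'Phi_n) = map_poly intr 'Phi_n.
  by rewrite -map_poly_comp; apply: eq_map_poly => a; rewrite /= ratr_int.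
have [z prim_z] := C_prim_root_exists n_gt0.
rewrite (Cintr_Cyclotomic prim_z).
apply: Pdiv.ClosedField.root_coprimep => w.
rewrite root_cyclotomic // => prim_w; apply/negP => qw0.
have [p [def_p _ dv_p]] := minCpolyP w.
have szp : size p = (totient n).+1.
  rewrite -(size_map_poly (@ratr algC)) -def_p (minCpoly_cyclotomic prim_w).
  exact: size_cyclotomic.
have: p %| q by rewrite -dv_p.
by move/(dvdp_leq q0); rewrite szp ltnNge szq.
Qed.

Lemma expr_root_Cyclotomic (K : fieldType) (n : nat) (z : K) :
  (0 < n)%N -> root (map_poly intr 'Phi_n) z -> z ^+ n = 1.
Proof.
move=> n_gt0 /rootP zn0.
have /(congr1 (horner_eval z \o map_poly intr)) := prod_Cyclotomic n_gt0.
rewrite (big_rem n) /=; last by rewrite -dvdn_divisors.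
rewrite !rmorphM /= /horner_eval zn0 mul0r rmorphB /= map_polyXn rmorph1.
by rewrite !hornerE => /eqP; rewrite eq_sym subr_eq0 => /eqP.
Qed.

(** z is a root of X^n - 1, hence of 'Phi_d for some divisor d of n; then
    z^d = 1, and primitivity forces d = n. *)
Lemma root_Cyclotomic (K : fieldType) (n : nat) (z : K) :
  n.-primitive_root z -> root (map_poly intr 'Phi_n) z.
Proof.
move=> prim_z; have n_gt0 := prim_order_gt0 prim_z.
have: root (map_poly intr (\prod_(d <- divisors n) 'Phi_d)) z.
  rewrite prod_Cyclotomic // rmorphB /= map_polyXn rmorph1.
  by rewrite rootE !hornerE (prim_expr_order prim_z) subrr.
rewrite rmorph_prod /= -(big_map (fun d => map_poly intr 'Phi_d) xpredT id).
rewrite -[root _ _]negbK root_bigmul all_map -has_predC.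
case/hasP=> d; rewrite -dvdn_divisors //= negbK => d_n zd.
have d_gt0 := dvdn_gt0 n_gt0 d_n.
suff <-: d = n by [].
apply/eqP; rewrite eqn_dvd d_n /= (prim_order_dvd prim_z).
by rewrite (expr_root_Cyclotomic d_gt0 zd).
Qed.

(** Coprimality of q and 'Phi_n over Q is preserved by f, so the
    irreducibility of 'Phi_n, known for algebraic numbers, can be used in any
    field. *)
Lemma prim_root_rat_poly_eq0 (K : fieldType) (f : {rmorphism rat -> K})
    (n : nat) (z : K) (q : {poly rat}) :
    n.-primitive_root z -> (size q <= totient n)%N ->
  (map_poly f q).[z] = 0 -> q = 0.
Proof.
move=> prim_z szq qz0; apply/eqP/idPn => q0.
have coq := coprimep_Cyclotomic (prim_order_gt0 prim_z) q0 szq.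
rewrite -(coprimep_map f) -map_poly_comp in coq.
have fE : f \o intr =1 intr by move=> a; rewrite /= rmorph_int.
rewrite (eq_map_poly fE) in coq.
by have := coprimep_root coq (root_Cyclotomic prim_z); rewrite qz0 eqxx.
Qed.

(** * Independence over Q(x) of the products of powers of zeta and t *)

(** The inner variable of W is specialized to z. The resulting polynomial has
    coefficients algebraic over F, so if it were nonzero its root t would be
    algebraic as well. *)
Lemma transcendental_over_algebraic (F K : fieldType)
    (f : {rmorphism F -> K}) (z t : K) (W : {poly {poly F}}) :
    integralOver f z -> ~ integralOver f t ->
    (map_poly (horner_eval z \o map_poly f) W).[t] = 0 ->
  map_poly (horner_eval z \o map_poly f) W = 0.
Proof.
move=> alg_z tr_t Wt0; apply/eqP/idPn => W0; case: tr_t.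
apply: (integral_root W0); first exact/rootP.
apply/integral_poly => i; rewrite coef_map /=.
apply: integral_horner => //; apply/integral_poly => j.
by rewrite coef_map; apply: integral_id.
Qed.

Section LaurentIndependence.

Variables (K : fieldType) (g : {rmorphism {poly rat} -> K}).
Hypothesis g_inj : forall p, g p = 0 -> p = 0.
Variables (n : nat) (z t : K).
Hypotheses (n_gt0 : (0 < n)%N) (prim_z : n.-primitive_root z) (t0 : t != 0).
Hypothesis gX : g 'X = t ^+ n + t ^- n.

Let f : {rmorphism rat -> K} := g \o polyC.

Lemma rmorph_poly_horner p : g p = (map_poly f p).[g 'X].
Proof.
rewrite -{1}[p]coefK poly_def rmorph_sum (horner_coef_wide _ (size_poly _ _)).
by apply: eq_bigr => i _; rewrite coef_map /= -mul_polyC rmorphM rmorphXn.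
Qed.

(** If t were algebraic, then so would be t^n + t^-n, the image of the
    variable under the injective map g. *)
Lemma laurent_variable_transcendental : ~ integralOver f t.
Proof.
move=> int_t; have int_tn e : integralOver f (t ^+ e).
  elim: e => [|e IHe]; first by rewrite expr0; apply: integral1.
  by rewrite exprS; apply: integral_mul.
have: integralOver f (g 'X).
  by rewrite gX; apply: integral_add => //; apply: integral_inv.
case=> p mon_p /rootP; rewrite -rmorph_poly_horner => /g_inj p0.
by move: mon_p; rewrite p0 monicE lead_coef0 eq_sym oner_eq0.
Qed.

(** Multiplied by t^(n d), where d bounds the degrees of the P i j, the
    relation becomes W(zeta, t) = 0 with
    W = sum_k R_k (T^2n + 1)^k T^(n (d - k)), where R_k collects the
    coefficients of the k-th powers of x. *)
Lemma laurent_independence (P : nat -> nat -> {poly rat}) :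
    \sum_(j < 2 * n) \sum_(i < totient n) g (P i j) * (z ^+ i * t ^+ j) = 0 ->
  forall i j, (i < totient n)%N -> (j < 2 * n)%N -> P i j = 0.
Proof.
move=> sum0.
pose d := \max_(j < 2 * n) \max_(i < totient n) size (P i j).
have szP i j : (i < totient n)%N -> (j < 2 * n)%N -> (size (P i j) <= d)%N.
  move=> lti ltj; apply: leq_trans (leq_bigmax (Ordinal ltj)).
  exact: (leq_bigmax (Ordinal lti)).
(* The outer variable stands for t, the inner one for zeta. *)
pose R k : {poly {poly rat}} :=
  \poly_(j < 2 * n) \poly_(i < totient n) (P i j)`_k.
pose e : {rmorphism {poly rat} -> K} := horner_eval z \o map_poly f.
pose W := \sum_(k < d.+1) R k * ('X^(2 * n) + 1) ^+ k * 'X^n ^+ (d - k).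
have eR k : (map_poly e (R k)).[t] =
    \sum_(j < 2 * n) \sum_(i < totient n) f (P i j)`_k * (z ^+ i * t ^+ j).
  rewrite (@horner_coef_wide _ (2 * n)); last first.
    by rewrite (leq_trans (size_poly _ _)) // size_poly.
  apply: eq_bigr => j _; rewrite coef_map coef_poly ltn_ord /= /horner_eval.
  rewrite (@horner_coef_wide _ (totient n)); last first.
    by rewrite (leq_trans (size_poly _ _)) // size_poly.
  rewrite mulr_suml; apply: eq_bigr => i _.
  by rewrite coef_map coef_poly ltn_ord mulrA.
have eA : map_poly e ('X^(2 * n) + 1) = 'X^(2 * n) + 1.
  by rewrite rmorphD rmorphXn rmorph1 /= map_polyX.
have eW : map_poly e W = \sum_(k < d.+1)
    map_poly e (R k) * ('X^(2 * n) + 1) ^+ k * 'X^n ^+ (d - k).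
  rewrite rmorph_sum; apply: eq_bigr => k _.
  by rewrite !rmorphM !rmorphXn /= eA map_polyX.
have Wt0 : (map_poly e W).[t] = 0.
  rewrite eW horner_sum.
  transitivity (t ^+ n ^+ d * \sum_(k < d.+1) \sum_(j < 2 * n)
      \sum_(i < totient n) f (P i j)`_k * (z ^+ i * t ^+ j) * (g 'X) ^+ k).
    rewrite mulr_sumr; apply: eq_bigr => k _.
    rewrite !hornerE eR.
    have -> : t ^+ (2 * n) + 1 = t ^+ n * g 'X.
      by rewrite gX mulrDr divff ?expf_neq0 // mul2n -addnn exprD.
    have <- : t ^+ n ^+ k * t ^+ n ^+ (d - k) = t ^+ n ^+ d.
      by rewrite -exprD subnKC // -ltnS.
    under [in RHS]eq_bigr do rewrite -mulr_suml.
    rewrite -mulr_suml exprMn -[LHS]mulrA.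
    by rewrite [_ * g 'X ^+ k * _]mulrAC mulrCA.
  rewrite exchange_big /= -[RHS](mulr0 (t ^+ n ^+ d)) -[in RHS]sum0.
  congr (_ * _).
  apply: eq_bigr => j _; rewrite exchange_big; apply: eq_bigr => i _ /=.
  rewrite [in RHS]rmorph_poly_horner (@horner_coef_wide _ d.+1); last first.
    by rewrite (leq_trans (size_poly _ _)) // leqW // szP.
  rewrite mulr_suml; apply: eq_bigr => k _.
  by rewrite coef_map mulrAC.
have alg_z : integralOver f z.
  exists ('X^n - 1); first exact: monicXnsubC.
  rewrite rmorphB /= map_polyXn rmorph1 rootE !hornerE.
  by rewrite prim_expr_order ?subrr.
have W0 :=
  transcendental_over_algebraic alg_z laurent_variable_transcendental Wt0.
have R0 : forall k, (k <= d)%N -> map_poly e (R k) = 0.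
  apply: (@homogeneous_form_eq0 K ('X^(2 * n) + 1) 'X^n (2 * n)).
  - rewrite coprimep_sym coprimep_expl // coprimep_sym coprimepX.
    rewrite rootE !hornerE expr0n muln_eq0 /= -leqn0 leqNgt n_gt0 add0r.
    by rewrite oner_eq0.
  - by rewrite -size_poly_gt0 size_polyXn.
  - by rewrite -polyC1 size_XnaddC // muln_gt0.
  - by rewrite size_polyXn ltnS leq_pmull.
  - by move=> k; rewrite (leq_trans (size_poly _ _)) // size_poly.
  - by rewrite -eW.
move=> i j lti ltj; apply/polyP => k; rewrite coef0.
have [lekd | ] := leqP k d; last first.
  by move=> ltdk; rewrite nth_default // (leq_trans (szP i j lti ltj)) // ltnW.
have /(congr1 (fun p : {poly K} => p`_j)) := R0 k lekd.
rewrite coef0 coef_map coef_poly ltj => /(prim_root_rat_poly_eq0 prim_z).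
rewrite size_poly => /(_ isT) /(congr1 (fun p : {poly rat} => p`_i)).
by rewrite coef_poly lti coef0.
Qed.

End LaurentIndependence.

(** * Roots of D and generators of the splitting field *)

Lemma separable_XnsubC (K : fieldType) (n : nat) (c : K) :
  n%:R != 0 :> K -> c != 0 -> separable_poly ('X^n - c%:P).
Proof.
case: n => [/eqP// | n nz_n c0]; rewrite unlock linearB /= derivC subr0.
rewrite derivXn -scaler_nat coprimepZr //= coprimep_expr // coprimepX.
by rewrite rootE !hornerE expr0n /= sub0r oppr_eq0.
Qed.

(** The quotients a / t are n distinct n-th roots of unity. *)
Lemma prim_root_of_roots_XnsubC (K : fieldType) (n : nat) (t : K) (s : seq K) :
    (0 < n)%N -> t != 0 -> uniq s -> (n <= size s)%N ->
    (forall a, a \in s -> a ^+ n = t ^+ n) ->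
  exists z : K, n.-primitive_root z.
Proof.
move=> n_gt0 t0 uniq_s sz_s s_n.
have: has n.-primitive_root [seq a / t | a <- s].
  apply: has_prim_root => //; last by rewrite size_map.
  - apply/allP=> _ /mapP[a sa ->]; rewrite unity_rootE expr_div_n s_n //.
    by rewrite divff ?expf_neq0.
  - by rewrite map_inj_uniq //; apply/mulIf; rewrite invr_eq0.
by case/hasP=> z _; exists z.
Qed.

Section SplittingField.

Variables (n : nat) (L : splittingFieldType Qx).
Hypothesis n_gt0 : (0 < n)%N.

(** The polynomials in x with rational coefficients, viewed in L. Restricting
    to them in place of all of Q(x) is what clearing denominators allows. *)
Definition Qx_eval : {rmorphism {poly rat} -> L} :=
  in_alg L \o @tofrac {poly rat}.

Lemma Qx_eval_inj p : Qx_eval p = 0 -> p = 0.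
Proof. by move/eqP; rewrite fmorph_eq0 tofrac_eq0 => /eqP. Qed.

Lemma natr_splitting_neq0 : n%:R != 0 :> L.
Proof.
rewrite -(rmorph_nat Qx_eval); apply/eqP => /Qx_eval_inj/eqP.
by rewrite -polyC_natr polyC_eq0 Num.Theory.pnatr_eq0 -leqn0 leqNgt n_gt0.
Qed.

Lemma map_D_poly :
  map_poly (in_alg L) (D_poly n) = 'X^(2 * n) - Qx_eval 'X *: 'X^n + 1.
Proof. by rewrite rmorphD rmorphB /= linearZ /= !map_polyXn rmorph1. Qed.

Section Root.

Variable t : L.
Hypothesis Dt : root (map_poly (in_alg L) (D_poly n)) t.

Lemma D_root_neq0 : t != 0.
Proof.
apply: contraTneq Dt => ->; rewrite map_D_poly rootE !hornerE !expr0n.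
by rewrite muln_eq0 /= -leqn0 leqNgt n_gt0 /= mulr0 subr0 add0r oner_eq0.
Qed.

Lemma D_root_Qx_eval : Qx_eval 'X = t ^+ n + t ^- n.
Proof.
move: Dt; rewrite map_D_poly rootE !hornerE => /eqP Dt0.
have tn0 := expf_neq0 n D_root_neq0.
apply: (mulIf tn0); rewrite mulrDl mulVf // -exprD addnn -mul2n.
by apply/esym/eqP; rewrite -subr_eq0 addrAC Dt0.
Qed.

Lemma D_factorization :
  map_poly (in_alg L) (D_poly n) =
    ('X^n - (t ^+ n)%:P) * ('X^n - (t ^- n)%:P).
Proof.
rewrite map_D_poly D_root_Qx_eval -mul_polyC polyCD mulrDr !mulrDl mulNr mulrN.
rewrite -exprD addnn mul2n mulrNN -polyCM divff ?expf_neq0 ?D_root_neq0 //.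
by rewrite opprD addrA [in RHS]addrA ['X^n * _]mulrC [_ - _ - _]addrAC.
Qed.

Lemma D_rootE (a : L) :
  root (map_poly (in_alg L) (D_poly n)) a
    = (a ^+ n == t ^+ n) || (a ^+ n == t ^- n).
Proof. by rewrite D_factorization rootM !rootE !hornerE !subr_eq0. Qed.

(** Otherwise t^2n = 1, and t would be algebraic over Q. *)
Lemma D_root_exprn_neqV : t ^+ n != t ^- n.
Proof.
apply/eqP=> tn_eq.
case: (laurent_variable_transcendental Qx_eval_inj D_root_Qx_eval).
exists ('X^(2 * n) - 1); first by rewrite monicXnsubC ?muln_gt0.
rewrite rmorphB /= map_polyXn rmorph1 rootE !hornerE mul2n -addnn exprD.
by rewrite {1}tn_eq mulVf ?subrr ?expf_neq0 ?D_root_neq0.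
Qed.

Lemma separable_D : separable_poly (map_poly (in_alg L) (D_poly n)).
Proof.
have t0 := D_root_neq0; have n0 := natr_splitting_neq0.
rewrite D_factorization separable_mul.
rewrite !separable_XnsubC ?invr_eq0 ?expf_neq0 //=.
have c0 : t ^- n - t ^+ n != 0 by rewrite subr_eq0 eq_sym D_root_exprn_neqV.
(* The two factors of D differ by a nonzero constant. *)
apply/Bezout_eq1_coprimepP.
exists ((t ^- n - t ^+ n)^-1%:P, - (t ^- n - t ^+ n)^-1%:P) => /=.
rewrite mulNr -mulrBr opprB [X in _ * X]addrC addrA subrK -polyCB -polyCM.
by rewrite mulVf.
Qed.

End Root.

(** The factor X^n - t^n of D has n distinct roots in L, and the quotients of
    these roots provide z. The list rs is returned as well, since the roots of
    D are counted again as possible images of t under the Galois group. *)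
Lemma splitting_generators :
    splitting_field_of (D_poly n) L ->
  exists (rs : seq L) (z t : L),
    [/\ size rs = (2 * n)%N,
        forall a, (a \in rs) = root (map_poly (in_alg L) (D_poly n)) a,
        root (map_poly (in_alg L) (D_poly n)) t, n.-primitive_root z
      & <<1 & [:: z; t]>>%VS = fullv].
Proof.
case=> rs Drs genL.
have rsE a : (a \in rs) = root (map_poly (in_alg L) (D_poly n)) a.
  by rewrite (eqp_root Drs) root_prod_XsubC.
have sz_rs : size rs = (2 * n)%N.
  apply: succn_inj; rewrite -[LHS](size_prod_XsubC rs id) -(eqp_size Drs).
  rewrite map_D_poly -addrA size_polyDl size_polyXn //.
  apply: (@leq_ltn_trans n.+1); last by rewrite ltnS ltn_Pmull.
  apply: (leq_trans (size_polyD _ _)); rewrite geq_max size_poly1 andbT.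
  by rewrite size_polyN (leq_trans (size_scale_leq _ _)) // size_polyXn.
pose t := nth 0 rs 0.
have rs_t : t \in rs by rewrite mem_nth // sz_rs muln_gt0.
have Dt : root (map_poly (in_alg L) (D_poly n)) t by rewrite -rsE.
have t0 := D_root_neq0 Dt.
have uniq_rs : uniq rs.
  by rewrite -separable_prod_XsubC -(eqp_separable Drs) (separable_D Dt).
have rs_pm a : a \in rs -> a ^+ n = t ^+ n \/ a ^+ n = t ^- n.
  by rewrite rsE (D_rootE Dt) => /orP[] /eqP; [left | right].
(* The sublist selected by m consists of the roots of the factor X^n - t^n. *)
have [m Dm] : {m | 'X^n - (t ^+ n)%:P %= \prod_(a <- mask m rs) ('X - a%:P)}.
  apply: dvdp_prod_XsubC; rewrite -(eqp_dvdr _ Drs) (D_factorization Dt).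
  exact: dvdp_mulIl.
have sz_m : size (mask m rs) = n.
  apply: succn_inj; rewrite -[LHS](size_prod_XsubC (mask m rs) id).
  by rewrite -(eqp_size Dm) size_XnsubC.
have [|a m_a|z prim_z] :=
    prim_root_of_roots_XnsubC n_gt0 t0 (mask_uniq uniq_rs m).
- by rewrite sz_m.
- move: m_a; rewrite -root_prod_XsubC -(eqp_root Dm) rootE !hornerE subr_eq0.
  by move/eqP.
exists rs, z, t; split=> //.
apply/eqP; rewrite eqEsubv subvf -genL /=; apply/Fadjoin_seqP.
split=> [|a rs_a]; first exact: subv_adjoin_seq.
have zE : z \in <<1 & [:: z; t]>>%VS by rewrite seqv_sub_adjoin ?mem_head.
have tE : t \in <<1 & [:: z; t]>>%VS.
  by rewrite seqv_sub_adjoin ?inE ?eqxx ?orbT.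
have E_root b c : b \in <<1 & [:: z; t]>>%VS -> b != 0 -> c ^+ n = b ^+ n ->
    c \in <<1 & [:: z; t]>>%VS.
  move=> Eb b0 cb; have : (c / b) ^+ n = 1.
    by rewrite expr_div_n cb divff ?expf_neq0.
  case/(prim_rootP prim_z) => i cbi.
  by rewrite -(divfK b0 c) cbi rpredM ?rpredX.
case: (rs_pm a rs_a) => [|] an; first exact: (E_root t).
by apply: (E_root t^-1); rewrite ?rpredV ?invr_eq0 ?exprVn.
Qed.

End SplittingField.

(** * Common denominators *)

Lemma fractionP (R : idomainType) (a : {fraction R}) :
  exists u : R * R, u.2 != 0 /\ tofrac u.2 * a = tofrac u.1.
Proof.
elim/quotW: a => x; exists (\n_x, \d_x); split; first exact: denom_ratioP.
unlock tofrac; rewrite -[LHS]FracField.pi_mul; apply/eqmodP => /=.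
rewrite FracField.equivfE /FracField.mulf.
rewrite !numden_Ratio ?oner_eq0 ?mulf_neq0 ?denom_ratioP ?oner_eq0 //.
by rewrite mul1r mulr1 mulrC.
Qed.

Lemma common_denominator (R : idomainType) (I : finType)
    (c : I -> {fraction R}) :
  exists (q : R) (p : I -> R),
    q != 0 /\ forall i, tofrac q * c i = tofrac (p i).
Proof.
have [u uP] := fin_all_exists (fun i => fractionP (c i)).
exists (\prod_i (u i).2), (fun i => (u i).1 * \prod_(j | j != i) (u j).2).
split=> [|i]; first by apply/prodf_neq0 => i _; case: (uP i).
by rewrite (bigD1 i) //= !rmorphM /= mulrAC; case: (uP i) => _ ->.
Qed.

(** * The Galois group as a set of pairs *)

Section GaloisGroup.

Variables (n : nat) (L : splittingFieldType Qx) (z t : L) (rs : seq L).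
Hypotheses (n_gt1 : (1 < n)%N) (splitL : splitting_field_of (D_poly n) L).
Hypothesis prim_z : n.-primitive_root z.
Hypothesis Dt : root (map_poly (in_alg L) (D_poly n)) t.
Hypothesis genL : <<1 & [:: z; t]>>%VS = fullv.
Hypothesis sz_rs : size rs = (2 * n)%N.
Hypothesis rsE : forall a, (a \in rs) = root (map_poly (in_alg L) (D_poly n)) a.

Let n_gt0 : (0 < n)%N := ltnW n_gt1.
Let t0 : t != 0 := D_root_neq0 n_gt0 Dt.
Let z0 : z != 0.
Proof.
apply/eqP => z_eq0; move/eqP: (prim_expr_order prim_z).
by rewrite z_eq0 expr0n eqn0Ngt n_gt0 eq_sym oner_eq0.
Qed.

(** The family of products z^i t^j is free: a linear relation between them with
    coefficients in Q(x) reduces, over a common denominator, to the case of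
    polynomial coefficients. *)
Lemma leq_dim_splitting : (totient n * (2 * n) <= \dim {:L})%N.
Proof.
pose T : finType := ('I_(totient n) * 'I_(2 * n))%type.
pose X := [tuple z ^+ (enum_val i).1 * t ^+ (enum_val i).2 | i < #|T|].
have -> : (totient n * (2 * n))%N = size X.
  by rewrite size_tuple card_prod !card_ord.
suff /eqP <- : free X by rewrite dimvS ?subvf.
apply/freeP => k kX0.
have [q [p [q0 qp]]] := common_denominator (fun u => k (enum_rank u)).
(* Extension by 0 of the numerators to all natural indices. *)
pose P i j := if insub i is Some i' then
  if insub j is Some j' then p (i', j') else 0 else 0.
have P0 : forall i j, (i < totient n)%N -> (j < 2 * n)%N -> P i j = 0.
  apply: (laurent_independence (@Qx_eval_inj L) n_gt0 prim_z
    (D_root_neq0 n_gt0 Dt) (D_root_Qx_eval n_gt0 Dt)).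
  rewrite exchange_big pair_big /=.
  transitivity (tofrac q *:
      \sum_(i < #|T|) k i *: (z ^+ (enum_val i).1 * t ^+ (enum_val i).2)).
    rewrite scaler_sumr (reindex (@enum_val T xpredT)) /=; last first.
      exact: onW_bij (enum_val_bij T).
    apply: eq_bigr => i _; rewrite /P !valK.
    by rewrite scalerA -[i in k i]enum_valK qp -surjective_pairing mulr_algl.
  apply/eqP; rewrite scaler_eq0; apply/orP; right; apply/eqP; rewrite -[RHS]kX0.
  by apply: eq_bigr => i _; rewrite -(tnth_nth 0) tnth_mktuple.
move=> i; have := P0 _ _ (ltn_ord (enum_val i).1) (ltn_ord (enum_val i).2).
rewrite /P !valK -surjective_pairing => pi0.
have /eqP := qp (enum_val i); rewrite pi0 rmorph0 mulf_eq0 tofrac_eq0.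
by rewrite (negPf q0) enum_valK => /eqP.
Qed.

Lemma D_polyOver : map_poly (in_alg L) (D_poly n) \is a polyOver 1%VS.
Proof. exact: alg_polyOver. Qed.

Lemma gal_D_root (s : gal_of {:L}) (a : L) :
    s \in 'Gal({:L} / 1)%g ->
    root (map_poly (in_alg L) (D_poly n)) a ->
  root (map_poly (in_alg L) (D_poly n)) (s a).
Proof.
move=> Gs Da; rewrite -(fixedPoly_gal (sub1v _) Gs D_polyOver).
by rewrite rmorph_root.
Qed.

(** The field fixed by s r^-1 contains z and t, hence is all of L. *)
Lemma gal_eq_on_generators (s r : gal_of {:L}) :
  s z = r z -> s t = r t -> s = r.
Proof.
move=> eq_z eq_t; pose w := (s * r^-1)%g.
have wE a : w a = r^-1%g (s a) by rewrite galM ?memvf.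
have rK a : r^-1%g (r a) = a by rewrite -galM ?memvf // mulgV gal_id.
have sub : (<<1 & [:: z; t]>> <= fixedField [set w])%VS.
  apply/Fadjoin_seqP; split; first exact: sub1v.
  move=> a; rewrite !inE => az; apply/fixedFieldP; first exact: memvf.
  move=> _ /set1P->; rewrite wE.
  by case/pred2P: az => ->; rewrite ?eq_z ?eq_t rK.
suff w1 : w = 1%g by rewrite -[s]mulg1 -(mulVg r) mulgA -/w w1 mul1g.
apply/eqP/gal_eqP => a _; rewrite gal_id.
have : a \in fixedField [set w] by apply: (subvP sub); rewrite genL memvf.
by case/mem_fixedFieldP => _ /(_ w (set11 w)).
Qed.

Lemma galois_splitting : galois 1 {:L}.
Proof.
apply/splitting_galoisField; exists (map_poly (in_alg L) (D_poly n)).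
by split=> //; [exact: D_polyOver | exact: separable_D Dt].
Qed.

Let zs := [seq z ^+ i | i : 'I_n in [pred i : 'I_n | coprime i n]].

(** The images of (z, t) are distinct pairs formed of a primitive root of unity
    and a root of D. There are phi(n) * 2n such pairs, and the dimension bound
    shows that as many are attained; so the two lists coincide. *)
Lemma gal_pairs :
  let im := [seq ((s : gal_of {:L}) z, s t) | s <- enum 'Gal({:L} / 1)%g] in
  size im = (totient n * (2 * n))%N /\ im =i [seq (a, b) | a <- zs, b <- rs].
Proof.
move=> im; have sz_zs : size zs = totient n.
  rewrite size_image totient_count_coprime -big_mkcond big_mkord -sum1_card.
  by apply: eq_bigl => k; rewrite coprime_sym.
have szP : size [seq (a, b) | a <- zs, b <- rs] = (totient n * (2 * n))%N.
  by rewrite size_allpairs sz_zs sz_rs.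
have uniq_im : uniq im.
  rewrite map_inj_in_uniq ?enum_uniq // => s r _ _ [].
  exact: gal_eq_on_generators.
have sub_im : {subset im <= [seq (a, b) | a <- zs, b <- rs]}.
  move=> ab /mapP[s]; rewrite mem_enum => Gs ->; apply: allpairs_f.
    have prim_sz : n.-primitive_root (s z) by rewrite fmorph_primitive_root.
    have [i sz] := prim_rootP prim_z (prim_expr_order prim_sz).
    rewrite sz; apply/imageP; exists i => //; rewrite inE.
    by rewrite -(prim_root_exp_coprime _ prim_z) -sz.
  by rewrite rsE gal_D_root // -rsE.
have sz_im : (size [seq (a, b) | a <- zs, b <- rs] <= size im)%N.
  rewrite szP size_map -cardE -(galois_dim galois_splitting) dimv1 divn1.
  exact: leq_dim_splitting.
by case: (uniq_min_size uniq_im sub_im sz_im) => ->.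
Qed.

Lemma card_gal_splitting : #|'Gal({:L} / 1)%g| = (totient n * (2 * n))%N.
Proof. by have [] := gal_pairs; rewrite size_map -cardE. Qed.

Lemma gal_exists a b :
    n.-primitive_root a -> root (map_poly (in_alg L) (D_poly n)) b ->
  exists2 s : gal_of {:L}, s \in 'Gal({:L} / 1)%g & s z = a /\ s t = b.
Proof.
move=> prim_a Db; have [_ im] := gal_pairs.
have : (a, b) \in [seq (a, b) | a <- zs, b <- rs].
  apply: allpairs_f; last by rewrite rsE.
  have [i ai] := prim_rootP prim_z (prim_expr_order prim_a).
  rewrite ai; apply/imageP; exists i => //; rewrite inE.
  by rewrite -(prim_root_exp_coprime _ prim_z) -ai.
rewrite -im => /mapP[s]; rewrite mem_enum => Gs [-> ->].
by exists s.
Qed.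

(** * The dihedral normal subgroup *)

Local Notation Gal := ('Gal({:L} / 1)%g).

(** The Galois group of L over Q(zeta)(x). *)
Definition cyclotomic_stabilizer := [set s in Gal | s z == z].

Lemma cyclotomic_stabilizer_group_set : group_set cyclotomic_stabilizer.
Proof.
apply/group_setP; split=> [|s r]; first by rewrite inE group1 gal_id /=.
rewrite !inE => /andP[Gs /eqP sz] /andP[Gr /eqP rz].
by rewrite groupM //= galM ?memvf // sz rz.
Qed.

Canonical cyclotomic_stabilizer_group := Group cyclotomic_stabilizer_group_set.

Local Notation H := cyclotomic_stabilizer.

Lemma gal_primitive_root (s : gal_of {:L}) : exists i, s z = z ^+ i.
Proof.
have prim_sz : n.-primitive_root (s z) by rewrite fmorph_primitive_root.
by have [i ->] := prim_rootP prim_z (prim_expr_order prim_sz); exists i.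
Qed.

(** An element h that fixes z fixes all powers of z, and these include every
    image of z under the Galois group; so conjugates of h fix z again. *)
Lemma gal_norm_cyclotomic_stabilizer : Gal \subset 'N(H)%g.
Proof.
apply/subsetP => s Gs; rewrite inE; apply/subsetP => x /imsetP[h].
rewrite inE => /andP[Gh /eqP hz] ->; rewrite inE groupJ //=.
rewrite conjgE !galM ?memvf //.
have hsV : h (s^-1%g z) = s^-1%g z.
  by have [i ->] := gal_primitive_root s^-1%g; rewrite rmorphXn /= hz.
by rewrite hsV -galM ?memvf // mulVg gal_id.
Qed.

Lemma card_cyclotomic_stabilizer_leq : (#|H| <= 2 * n)%N.
Proof.
rewrite -sz_rs cardE -(size_map (fun s : gal_of {:L} => s t)).
apply: uniq_leq_size.
  rewrite map_inj_in_uniq ?enum_uniq // => s r; rewrite !mem_enum !inE.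
  case/andP=> _ /eqP sz /andP[_ /eqP rz]; apply: gal_eq_on_generators.
  by rewrite sz rz.
move=> a /mapP[s]; rewrite mem_enum inE => /andP[Gs _] ->.
by rewrite rsE gal_D_root.
Qed.

Lemma cyclotomic_stabilizer_generators :
  exists r s : gal_of {:L},
    [/\ r \in H, s \in H, r t = z * t & s t = t^-1].
Proof.
have Dzt : root (map_poly (in_alg L) (D_poly n)) (z * t).
  by rewrite (D_rootE n_gt0 Dt) exprMn (prim_expr_order prim_z) mul1r eqxx.
have DtV : root (map_poly (in_alg L) (D_poly n)) t^-1.
  by rewrite (D_rootE n_gt0 Dt) exprVn eqxx orbT.
have [r Gr [rz rt]] := gal_exists prim_z Dzt.
have [s Gs [sz st]] := gal_exists prim_z DtV.
by exists r, s; split; rewrite // inE ?Gr ?Gs ?rz ?sz eqxx.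
Qed.

(** The generators r and s satisfy the relations of the dihedral group. They
    generate all of H because r has order n and s is not a power of r, while
    H has at most 2n elements, one for each possible image of t. *)
Lemma cyclotomic_stabilizer_dihedral : H \isog 'D_(2 * n).
Proof.
have [r [s [Hr Hs rt st]]] := cyclotomic_stabilizer_generators.
have [/andP[_ /eqP rz] /andP[_ /eqP sz]] :
  (r \in Gal) && (r z == z) /\ (s \in Gal) && (s z == z).
  by rewrite !inE in Hr Hs.
have rXz i : (r ^+ i)%g z = z.
  by elim: i => [|i IHi]; rewrite ?gal_id // expgSr galM ?memvf // IHi rz.
have rXt i : (r ^+ i)%g t = z ^+ i * t.
  elim: i => [|i IHi]; first by rewrite gal_id mul1r.
  by rewrite expgSr galM ?memvf // IHi rmorphM rmorphXn /= rz rt mulrA exprSr.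
have r_order i : ((r ^+ i)%g == 1%g) = (n %| i)%N.
  apply/eqP/idP => [ri1 | n_i].
    rewrite (prim_order_dvd prim_z); apply/eqP/(mulIf t0).
    by rewrite -rXt ri1 gal_id mul1r.
  apply: gal_eq_on_generators; rewrite gal_id ?rXz // rXt.
  by move: n_i; rewrite (prim_order_dvd prim_z) => /eqP->; rewrite mul1r.
have or : #[r]%g = n.
  apply/eqP; rewrite eqn_dvd order_dvdn r_order dvdnn -r_order expg_order.
  exact: eqxx.
have s2 : (s ^+ 2 = 1)%g.
  rewrite expgS expg1; apply: gal_eq_on_generators.
    by rewrite galM ?memvf // gal_id !sz.
  by rewrite galM ?memvf // gal_id st fmorphV /= st invrK.
have rsr : (r * s * r = s)%g.
  apply: gal_eq_on_generators.
    by rewrite !galM ?memvf // rz sz rz.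
  rewrite !galM ?memvf // rt rmorphM /= sz st rmorphM fmorphV /= rz rt.
  by rewrite invfM mulrA divff // mul1r.
(* A power of r fixes t^n, which s exchanges with t^-n. *)
have s_notin : s \notin <[r]>%g.
  apply/negP => /cycleP[i s_ri]; case/eqP: (D_root_exprn_neqV n_gt0 Dt).
  move: st; rewrite s_ri rXt => /(congr1 (fun a => a ^+ n)).
  by rewrite exprMn exprAC (prim_expr_order prim_z) expr1n mul1r exprVn.
have subH : (<[r]> <*> <[s]> \subset H)%g.
  by rewrite join_subG !cycle_subG Hr Hs.
have cardH : (2 * n <= #|(<[r]> <*> <[s]>)%g|)%N.
  have /dvdnP[k def_k] : (n %| #|(<[r]> <*> <[s]>)%g|)%N.
    by rewrite -{1}or cardSg // joing_subl.
  have : (<[r]> \proper <[r]> <*> <[s]>)%g.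
    rewrite properE joing_subl; apply: contra s_notin => sub.
    by rewrite (subsetP sub) // mem_gen // inE cycle_id orbT.
  move/proper_card; rewrite -orderE or def_k -{1}[n]mul1n ltn_pmul2r //.
  by move=> k_gt1; rewrite leq_mul2r k_gt1 orbT.
have defH : (<[r]> <*> <[s]>)%g = H.
  apply/eqP; rewrite eqEcard subH.
  exact: leq_trans card_cyclotomic_stabilizer_leq cardH.
rewrite mul2n; apply/(isoGrpP _ (Grp_dihedral n_gt1)); split.
  rewrite card_dihedral // -mul2n; apply/eqP.
  rewrite eqn_leq card_cyclotomic_stabilizer_leq.
  exact: leq_trans cardH (subset_leq_card subH).
apply/existsP; exists (r, s) => /=; apply/eqP; rewrite defH s2.
have -> : (r ^+ n = 1)%g by rewrite -or expg_order.
suff -> : (r ^ s = r^-1)%g by [].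
by rewrite conjgE (canRL (mulgK r) rsr) mulKg.
Qed.

Lemma gal_pm (s : gal_of {:L}) : s \in Gal ->
  s (t ^+ n) = t ^+ n \/ s (t ^+ n) = t ^- n.
Proof.
move=> Gs; have := gal_D_root Gs Dt; rewrite (D_rootE n_gt0 Dt) -rmorphXn /=.
by case/orP=> /eqP; [left | right].
Qed.

(** As s fixes t^n, it sends t to z^i t. Commuting with t |-> z t gives
    s z = z, and commuting with t |-> t^-1 gives z^i = z^-i; as n is odd, this
    implies z^i = 1. *)
Lemma cent_cyclotomic_stabilizer_eq1 (s : gal_of {:L}) :
    odd n -> s \in Gal -> s \in 'C(H)%g -> s (t ^+ n) = t ^+ n -> s = 1%g.
Proof.
move=> n_odd Gs cHs sy.
have [r [c [Hr Hc rt ct]]] := cyclotomic_stabilizer_generators.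
have [/andP[_ /eqP rz] /andP[_ /eqP cz]] :
  (r \in Gal) && (r z == z) /\ (c \in Gal) && (c z == z).
  by rewrite !inE in Hr Hc.
have [i st] : exists i, s t = z ^+ i * t.
  have : (s t / t) ^+ n = 1.
    by rewrite expr_div_n -rmorphXn /= sy divff ?expf_neq0.
  by case/(prim_rootP prim_z) => i sti; exists i; rewrite -sti divfK.
have zi0 : z ^+ i != 0 by rewrite expf_neq0.
have comm h : h \in H -> s (h t) = h (s t).
  by move=> Hh; rewrite -!galM ?memvf // (centP cHs h Hh).
apply: gal_eq_on_generators; rewrite gal_id.
  have := comm r Hr; rewrite st rt !rmorphM rmorphXn /= st rz rt mulrCA.
  by move/(mulfI zi0)/(mulIf t0).
have := comm c Hc; rewrite st ct fmorphV rmorphM rmorphXn /= st cz ct invfM.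
move/(mulIf (invr_neq0 t0)) => /(congr1 ( *%R (z ^+ i))).
rewrite divff // -exprD addnn -muln2 => /esym/eqP.
rewrite -(prim_order_dvd prim_z) Gauss_dvdl ?coprimen2 // => n_i.
by move: n_i; rewrite (prim_order_dvd prim_z) => /eqP->; rewrite mul1r.
Qed.

End GaloisGroup.

Local Close Scope ring_scope.

(** * Automorphisms of a dihedral group of order 2n, n odd *)

Section OddDihedral.

Variables (n : nat) (gT : finGroupType) (G : {group gT}).
Hypotheses (n_gt1 : 1 < n) (n_odd : odd n) (dihG : G \isog 'D_(2 * n)).

(** The presentation provides elements with #[r] <= n and #[s] <= 2; both are
    equalities because their product must reach the order 2n of G. *)
Lemma dihedral_generators :
  exists r s : gT, [/\ #[r] = n, #[s] = 2, <[r]> <| G & <[r]> * <[s]> = G].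
Proof.
have n_gt0 := ltnW n_gt1; have := dihG; rewrite mul2n.
case/(isoGrpP G (Grp_dihedral n_gt1)) => cardG homG.
rewrite card_dihedral // in cardG.
case/existsP: homG => -[r s] /= /eqP[defG rn s2 rs].
have nrs : <[s]> \subset 'N(<[r]>).
  by rewrite cycle_subG; apply/normP; rewrite -cycleJ rs cycleV.
have {}defG : <[r]> * <[s]> = G by rewrite -norm_joinEr.
have le_r : #[r] <= n by rewrite dvdn_leq // order_dvdn rn.
have le_s : #[s] <= 2 by rewrite dvdn_leq // order_dvdn s2.
have le_rs : n * 2 <= #[r] * #[s].
  by rewrite mul_cardG defG cardG muln2 leq_pmulr // cardG_gt0.
have or : #[r] = n.
  apply/eqP; rewrite eqn_leq le_r -(leq_pmul2r (isT : 0 < 2)).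
  by rewrite (leq_trans le_rs) // leq_mul2l le_s orbT.
exists r, s; split=> //.
  by apply/eqP; rewrite eqn_leq le_s -(leq_pmul2l n_gt0) -{2}or.
by rewrite /normal -defG mulG_subl mul_subG // normG.
Qed.

(** An automorphism is determined by its values at r and s. As n is odd, <[r]>
    is the set of elements of odd order in G, so the value at r is a generator
    of <[r]>, and the value at s is one of the n elements outside <[r]>. *)
Lemma card_Aut_dihedral_leq : #|Aut G| <= totient n * n.
Proof.
have [r [s [or os nrG defG]]] := dihedral_generators.
have cardG : #|G| = n.*2.
  have := dihG; rewrite mul2n => /card_isog ->.
  by rewrite card_dihedral.
have hallr : 2^'.-Hall(G) <[r]>.
  rewrite /pHall normal_sub // /pgroup -orderE or -odd_2'nat n_odd.
  by rewrite -divgS ?normal_sub // cardG -orderE or -muln2 mulKn ?(ltnW n_gt1).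
have in_r x : x \in G -> (x \in <[r]>) = odd #[x].
  by move=> Gx; rewrite (mem_normal_Hall hallr) // odd_2'nat.
have Gr : r \in G by rewrite (subsetP (normal_sub nrG)) ?cycle_id.
have Gs : s \in G by rewrite -defG (subsetP (mulG_subr _ _)) ?cycle_id.
pose F (a : {perm gT}) := (a r, a s).
have autG (a : {perm gT}) x :
    a \in Aut G -> x \in G -> a x \in G /\ #[a x] = #[x].
  move=> Aa Gx; split; first exact: Aut_closed.
  by rewrite -(autmE Aa) order_injm ?injm_autm.
have injF : {in Aut G &, injective F}.
  move=> a b Aa Ab [eq_r eq_s]; apply: (eq_Aut Aa Ab) => x.
  rewrite -defG => /mulsgP[_ _ /cycleP[i ->] /cycleP[j ->] ->].
  rewrite -(autmE Aa) -(autmE Ab) !morphM ?morphX ?groupX //=.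
  by rewrite !autmE eq_r eq_s.
rewrite -(card_in_imset injF).
pose Y := setX [set x | generator <[r]> x] (G :\: <[r]>).
have -> : (totient n * n)%N = #|Y|.
  rewrite cardsX -totient_gen or cardsD (setIidPr (normal_sub nrG)) cardG.
  by rewrite -orderE or -addnn addnK.
apply: subset_leq_card; apply/subsetP => _ /imsetP[a Aa ->].
have [Gar oar] := autG a r Aa Gr; have [Gas oas] := autG a s Aa Gs.
rewrite !inE /= in_r // oas os Gas !andbT.
rewrite /generator eq_sym eqEcard cycle_subG in_r // oar or n_odd -!orderE oar.
by rewrite /= or.
Qed.

End OddDihedral.

(** * The isomorphism *)

Unset Implicit Arguments.

Theorem theorem51 (n : nat) (n_gt1 : 1 < n) (n_odd : odd n)
    (L : splittingFieldType Qx) (splitL : splitting_field_of (D_poly n) L)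
    (gT : finGroupType) (G : {group gT}) (dihG : G \isog 'D_(2 * n))
    (hT : finGroupType) (C : {group hT}) (oC : #|C| = 2) :
  'Gal({:L} / 1) \isog setX (Aut G) C.
Proof.
have n_gt0 := ltnW n_gt1.
have [rs [z [t [sz_rs rsE Dt prim_z genL]]]] :=
  splitting_generators n_gt0 splitL.
have isoH :=
  cyclotomic_stabilizer_dihedral n_gt1 splitL prim_z Dt genL sz_rs rsE.
pose Gal := 'Gal({:L} / 1)%G; change (Gal \isog setX (Aut G) C).
have card_gal : #|Gal| = (totient n * (2 * n))%N.
  exact: (card_gal_splitting n_gt1 splitL prim_z Dt genL sz_rs rsE).
pose H := cyclotomic_stabilizer_group z.
have nHGal : Gal \subset 'N(H) := gal_norm_cyclotomic_stabilizer prim_z.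
have [h injh defG] : exists2 h : {morphism H >-> gT}, 'injm h & h @* H = G.
  by apply/isogP; rewrite (isog_trans isoH) // isog_sym.
have [c Cc c_neq1] : exists2 c, c \in C & c != 1.
  by apply/trivgPn; rewrite trivg_card1 oC.
have cc : c * c = 1 by have := expg_cardG Cc; rewrite oC expgS expg1.
pose y : L := (t ^+ n)%R.
pose sgn (s : gal_of {:L}) := if s y == y then 1 else c.
(* Conjugation on H, transported to G along the isomorphism h. *)
pose act (s : gal_of {:L}) := Aut_isom injh (subxx H) (conj_aut H s).
have yV_neq : ((y^-1)%R == y) = false.
  by apply/negbTE; rewrite eq_sym; apply: D_root_exprn_neqV.
have Gal_y s : s \in Gal -> s y = y \/ s y = (y^-1)%R.
  exact: gal_pm.
have sgnM : {in Gal &, {morph sgn : s r / s * r}}.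
  move=> s r Gs Gr; rewrite /sgn galM ?memvf //.
  have [-> | ->] := Gal_y s Gs; first by rewrite eqxx mul1g.
  rewrite fmorphV /= yV_neq.
  have [-> | ->] := Gal_y r Gr; first by rewrite eqxx yV_neq mulg1.
  by rewrite invrK eqxx yV_neq cc.
have AutH s : conj_aut H s \in Aut H by apply: Aut_aut.
have actM : {in Gal &, {morph act : s r / s * r}}.
  move=> s r Gs Gr; rewrite /act morphM ?(subsetP nHGal) //=.
  by rewrite Aut_isomM.
pose f s := (act s, sgn s).
have fM : {in Gal &, {morph f : s r / s * r}}.
  by move=> s r Gs Gr; rewrite /f actM // sgnM.
pose fm := Morphism fM.
have inj_f : 'injm fm.
  apply/subsetP => s /morphpreP[Gs /set1P[act1 sgn1]]; apply/set1P.
  have cHs : s \in 'C(H).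
    rewrite -ker_conj_aut; apply/kerP; rewrite ?(subsetP nHGal) //=.
    apply: (injmP (injm_Aut_isom injh (subxx H))) => //.
    by rewrite morph1; apply: act1.
  apply: (cent_cyclotomic_stabilizer_eq1 n_gt1 splitL prim_z Dt genL sz_rs rsE)
    => //.
  by move: sgn1; rewrite /sgn; case: eqP => // _ c1; rewrite c1 eqxx in c_neq1.
apply/isogP; exists fm => //; apply/eqP; rewrite eqEcard; apply/andP; split.
  apply/subsetP => x /morphimP[s _ Gs ->]; rewrite in_setX; apply/andP; split.
    by rewrite /= -defG Aut_Aut_isom.
  by rewrite /= /sgn; case: ifP.
rewrite card_injm // card_gal cardsX oC mulnC (mulnCA (totient n)) leq_mul2l /=.
exact: card_Aut_dihedral_leq.
Qed.
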